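(* Let $s \geq 3$ be an integer. Then: (i) There exists a constant $c>0$ depending only on $s$ such that for every integer $m \geq 2$ and every graph $G$ with $m$ edges, $$r(K_s,G) \geq c\,\big(m/\log m\big)^{\frac{s+1}{s+3}}.$$ (ii) There exists a constant $C>0$ depending only on $s$ such that for every sufficiently large integer $m$ there exists a graph $G$ with $m$ edges satisfying $$r(K_s,G) \leq C\, \frac{m^{\frac{s-1}{s}}}{(\log m)^{\frac{s-2}{s}}}.$$
   Context: For graphs $H$ and $G$, the Ramsey number $r(H,G)$ is the smallest positive integer $n$ such that every red-blue coloring of the edges of the complete graph $K_n$ on $n$ vertices contains either a red copy of $H$ or a blue copy of $G$. $K_s$ denotes the complete graph on $s$ vertices. The size of a graph is its number of edges. Logarithms are natural. *)

(* Defs.v *)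
From Stdlib Require Import Reals ClassicalDescription.
From mathcomp Require Import all_boot.
Set Implicit Arguments. Unset Strict Implicit. Unset Printing Implicit Defensive.

Definition simple_graph (V : finType) (G : rel V) : Prop :=
  irreflexive G /\ symmetric G.

Definition n_edges (V : finType) (G : rel V) : nat :=
  #|[set e : {set V} | [exists x, exists y, G x y && (e == [set x; y])]]|.

(* A red-blue colouring of the edges of K_n is given by its set Red of red
   edges (2-subsets of 'I_n); every other edge {u,v} (u <> v) is blue. *)
Definition has_red_Ks (s n : nat) (Red : {set {set 'I_n}}) : bool :=
  [exists f : {ffun 'I_s -> 'I_n}, injectiveb f &&
     [forall i, forall j, (i != j) ==> ([set f i; f j] \in Red)]].

Definition has_blue_copy (V : finType) (G : rel V) (n : nat)
    (Red : {set {set 'I_n}}) : bool :=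
  [exists f : {ffun V -> 'I_n}, injectiveb f &&
     [forall x, forall y, G x y ==> ([set f x; f y] \notin Red)]].

Definition ramsey_prop (s : nat) (V : finType) (G : rel V) (n : nat) : bool :=
  [forall Red : {set {set 'I_n}}, has_red_Ks s Red || has_blue_copy G Red].

(* r(K_s, G): least n with the Ramsey property (0 if none exists, which never
   happens for finite graphs). *)
Definition ramsey (s : nat) (V : finType) (G : rel V) : nat :=
  match excluded_middle_informative (exists n, ramsey_prop s G n) with
  | left h => ex_minn h
  | right _ => 0
  end.

(* Main.v *)
(** Part (i): give a set of red edges B of K_n the weight x ^ #|B| with
    x ~ n ^ (-2/(s+1)) and delete a maximal edge-disjoint family of red K_s from it.
    An embedding of G loses all its red edges only if, for some edge-disjoint
    family F of red K_s touching it, all its edges outside F are blue.  Summing over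
    F, one embedding fails with relative weight at most
    (1 + x) ^ -m * (1 + x ^ C(s,2)) ^ (m n ^ (s-2)), and there are at most n ^ n
    embeddings as soon as #|V| <= n.

    Part (ii): take for G a subgraph of j disjoint copies of K_t, where j t is of the
    order of the Ajtai-Komlos-Szemeredi bound
    r(K_s, K_t) = O(t ^ (s-1) / (ln t) ^ (s-2)); blue copies of K_t can then be
    removed greedily.  That bound follows by induction on s from the existence of
    independent sets of size n ln (d / (lam + 1)) / (16 d) in graphs with maximum
    degree d and codegrees at most lam along edges, obtained by computing the local
    occupancy of the hard-core model at fugacity 1 / (lam + 1). *)
Require Import Defs.
From Stdlib Require Import Reals Lra ZArith ClassicalDescription.
From mathcomp Require Import all_boot.
From mathcomp Require all_order all_algebra lra Rstruct.
Set Implicit Arguments. Unset Strict Implicit. Unset Printing Implicit Defensive.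

(** * Random deletion *)

Section Deletion.
Import all_order all_algebra.
Import Order.TTheory GRing.Theory Num.Theory.
Local Open Scope ring_scope.

Lemma sum_expr_card_subset (R : comNzRingType) (T : finType) (A : {set T}) (x : R) :
  \sum_(B : {set T} | B \subset A) x ^+ #|B| = (1 + x) ^+ #|A|.
Proof.
rewrite -[RHS]prodr_const [RHS]big_mkcond /=.
rewrite [RHS](eq_bigr (fun i => (if i \in A then x else 0) + 1)); last first.
  by move=> i _; case: ifP => _; rewrite ?add0r // addrC.
rewrite bigA_distr /= big_mkcond /=; apply: eq_bigr => B _.
case: ifPn => [BA | /subsetPn[i iB iA]].
  rewrite -big_mkcond /= (eq_bigr (fun=> x)) ?prodr_const // => i iB.
  by rewrite (subsetP BA).
by rewrite (bigD1 i) //= iB (negPf iA) mul0r.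
Qed.

(** The sum factors over the elements of [T]: those of [F] must lie in [B] (factor [x]), those of
    [E] outside [F] must not (factor 1), the others are free (factor [1 + x]). *)
Lemma sum_expr_card_trace (R : realDomainType) (T : finType) (E F : {set T}) (x : R) :
  0 <= x ->
  (\sum_(B : {set T} | (F \subset B) && (B :&: E \subset F)) x ^+ #|B|)
    * (1 + x) ^+ #|E| <= x ^+ #|F| * (1 + x) ^+ #|T|.
Proof.
move=> x0.
have x1 : 1 <= 1 + x by rewrite lerDl.
pose a i := if (i \in F) || (i \notin E) then x else 0.
pose b i : R := if i \in F then 0 else 1.
have -> : \sum_(B : {set T} | (F \subset B) && (B :&: E \subset F)) x ^+ #|B|
          = \prod_i (a i + b i).
  rewrite bigA_distr /= big_mkcond /=; apply: eq_bigr => B _.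
  case: ifPn => [/andP[FB BE] | ].
    rewrite -prodr_const big_mkcond /=; apply: eq_bigr => i _.
    rewrite /a /b; case: (boolP (i \in B)) => iB; last first.
      by rewrite (contraNF (subsetP FB i) iB).
    case: (boolP (i \in F)) => //= iF; case: (boolP (i \in E)) => // iE.
    by move/subsetP: BE => /(_ i); rewrite inE iB iE (negPf iF) => /(_ isT).
  rewrite negb_and => /orP[/subsetPn[i iF iB] | /subsetPn[i]].
    by rewrite (bigD1 i) //= (negPf iB) /b iF mul0r.
  by rewrite inE => /andP[iB iE] iF; rewrite (bigD1 i) //= iB /a (negPf iF) iE mul0r.
rewrite -!prodr_const [X in _ * X]big_mkcond [X in _ <= X * _]big_mkcond /=.
rewrite -!big_split /=; apply: ler_prod => i _; rewrite /a /b.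
have x10 : 0 <= 1 + x := le_trans ler01 x1.
case: (i \in F) => /=; case: (i \in E) => /=;
  rewrite ?addr0 ?add0r ?mulr1 ?mul1r ?(addrC x 1) //= ?mulr_ge0 ?lexx ?x10 //=.
by rewrite x0 -[leLHS]mulr1 ler_wpM2l.
Qed.

(** A nonempty member of [KK] left inside [B :\: cover D] could be added to an inclusion-maximal
    [D]. *)
Lemma maximal_disjoint_subfamily (T : finType) (KK : {set {set T}}) (B : {set T}) :
  exists D : {set {set T}},
    [/\ D \subset KK, trivIset D, cover D \subset B &
        forall K, K \in KK -> K != set0 -> ~~ (K \subset B :\: cover D)].
Proof.
pose P (D : {set {set T}}) := [&& D \subset KK, trivIset D & cover D \subset B].
have P0 : P set0.
  by rewrite /P sub0set /cover big_set0 sub0set andbT; apply/trivIsetP => A A'; rewrite inE.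
have [D /maxsetP[/and3P[D1 D2 D3] maxD] _] := maxset_exists P0.
exists D; split=> // K KK0 Kn0; apply/negP => KB.
have Kdis : [disjoint K & cover D].
  by move: KB; rewrite subsetD => /andP[].
have KD : K \notin D.
  apply: contra Kn0 => KD; rewrite -subset0; apply/subsetP => i iK.
  rewrite inE; move/pred0P: Kdis => /(_ i) /=; rewrite iK /= => /negP[].
  by apply/bigcupP; exists K.
have : P (K |: D).
  apply/and3P; split.
  - by rewrite subUset sub1set KK0.
  - apply/trivIsetP => A A'; rewrite !inE.
    have dK C : C \in D -> [disjoint K & C].
      move=> CD; apply: disjointWr Kdis; exact: bigcup_sup.
    case/predU1P => [-> | AD]; case/predU1P => [-> | A'D]; rewrite ?eqxx // => neq.
    + exact: dK.
    + by rewrite disjoint_sym; exact: dK.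
    + by move/trivIsetP: D2; apply.
  - rewrite /cover bigcup_setU big_set1 subUset -/(cover D) D3 andbT.
    by move: KB; rewrite subsetD => /andP[].
move=> /maxD/(_ (subsetUr _ _)) DK; move: KD; rewrite -DK; by rewrite setU11.
Qed.

(* Choose B with weight x ^+ #|B| and delete a maximal disjoint
   family of members of KK.  If E i is destroyed, then B meets E i only inside the
   members F of that family which touch E i; the union bound runs over F. *)
Lemma random_deletion (R : realFieldType) (T I : finType) (P : pred I)
    (E : I -> {set T}) (KK : {set {set T}}) (b m M : nat) (x : R) :
  0 < x -> (0 < b)%N ->
  (forall K, K \in KK -> #|K| = b) ->
  (forall i, P i -> #|E i| = m) ->
  (forall i, P i -> (#|[set K in KK | K :&: E i != set0]| <= M)%N) ->
  #|P|%:R * (1 + x ^+ b) ^+ M < (1 + x) ^+ m ->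
  exists B : {set T}, (forall K, K \in KK -> ~~ (K \subset B)) /\
                      (forall i, P i -> B :&: E i != set0).
Proof.
move=> x0 b0 cardK cardE touch small.
have x0' := ltW x0.
have x1 : 1 <= 1 + x by rewrite lerDl.
have x1p k : 0 < (1 + x) ^+ k by rewrite exprn_gt0 // (lt_le_trans ltr01).
pose KE i := [set K in KK | K :&: E i != set0].
(* [F] certifies that [E i] may be destroyed: a disjoint family inside [B], each member touching
   [E i], that covers all of [B :&: E i]. *)
pose bad i (F : {set {set T}}) (B : {set T}) :=
  [&& P i, F \subset KE i, trivIset F, cover F \subset B & B :&: E i \subset cover F].
suff [B goodB] : exists B, forall i F, ~~ bad i F B.
  have [D [D1 D2 D3 D4]] := maximal_disjoint_subfamily KK B.
  exists (B :\: cover D); split=> [K KK0 | i Pi].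
    by apply: D4 => //; rewrite -card_gt0 cardK.
  apply/negP => /eqP empty.
  (* If deletion empties [E i], the deleted members that touch [E i] form such a certificate. *)
  have /negP[] := goodB i [set K in D | K :&: E i != set0].
  have subD : [set K in D | K :&: E i != set0] \subset D.
    by apply/subsetP => K; rewrite inE => /andP[].
  apply/and5P; split=> //.
  - by apply/subsetP => K; rewrite !inE => /andP[KD ->]; rewrite (subsetP D1).
  - apply/trivIsetP => A A' AD A'D; move/trivIsetP: D2; apply; exact: (subsetP subD).
  - apply: subset_trans D3; apply/bigcupsP => K KD; apply: bigcup_sup.
    exact: (subsetP subD).
  - apply/subsetP => e; rewrite inE => /andP[eB eE].
    have : e \notin (B :\: cover D) :&: E i by rewrite empty inE.
    rewrite !inE eB eE !andbT negbK => /bigcupP[K KD eK].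
    apply/bigcupP; exists K => //; rewrite inE KD; apply/set0Pn; exists e.
    by rewrite inE eK.
have badw i F : \sum_(B | bad i F B) x ^+ #|B|
    <= (if P i && (F \subset KE i) then (x ^+ b) ^+ #|F| * ((1 + x) ^+ #|T| / (1 + x) ^+ m) else 0).
  case: ifPn => [/andP[Pi FK] | nPF]; last first.
    by rewrite big_pred0 // => B; rewrite /bad andbA (negPf nPF).
  case: (boolP (trivIset F)) => [trF | ntrF]; last first.
    rewrite big_pred0 => [|B]; last by rewrite /bad (negPf ntrF) !andbF.
    by rewrite !mulr_ge0 ?exprn_ge0 ?invr_ge0 ?exprn_ge0 // ltW // (lt_le_trans ltr01).
  have cF : #|cover F| = (b * #|F|)%N.
    have /eqP <- : \sum_(A in F) #|A| == #|cover F| by rewrite eq_sym (leq_card_cover F).2.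
    rewrite (eq_bigr (fun=> b)) ?sum_nat_const 1?mulnC // => K KF.
    by apply: cardK; move/subsetP: FK => /(_ _ KF); rewrite inE => /andP[].
  rewrite mulrA ler_pdivlMr // -exprM -cF -(cardE i Pi).
  rewrite (eq_bigl (fun B : {set T} => (cover F \subset B) && (B :&: E i \subset cover F))).
    exact: sum_expr_card_trace.
  by move=> B; rewrite /bad Pi FK trF.
have badt : \sum_i \sum_F \sum_(B | bad i F B) x ^+ #|B| < (1 + x) ^+ #|T|.
  apply: (@le_lt_trans _ _ (#|P|%:R * (1 + x ^+ b) ^+ M * ((1 + x) ^+ #|T| / (1 + x) ^+ m))).
    rewrite -[X in _ <= X]mulrA -sumr_const mulr_suml.
    rewrite [X in _ <= X]big_mkcond /=; apply: ler_sum => i _.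
    apply: le_trans (ler_sum _ (fun F _ => badw i F)) _.
    case: ifPn => [Pi | nPi]; last first.
      by rewrite big1 // => F _; rewrite (_ : P i = false) //; apply: negbTE.
    have Pi' : P i by [].
    (* With disjointness of [F] dropped, the sum of [(x ^+ b) ^+ #|F|] is binomial, equal to
       [(1 + x ^+ b) ^+ #|KE i|]. *)
    rewrite mul1r Pi' /= -big_mkcond -mulr_suml sum_expr_card_subset ler_wpM2r //.
      by rewrite divr_ge0 // ltW.
    by rewrite ler_weXn2l ?touch // lerDl exprn_ge0.
  by rewrite mulrA ltr_pdivrMr // [ltRHS]mulrC ltr_pM2r.
case: (boolP [exists B, [forall i, [forall F, ~~ bad i F B]]]) => [/existsP[B /forallP H]|].
  by exists B => i F; move/forallP: (H i); apply.
rewrite negb_exists => /forallP nob.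
(* Were every [B] bad, the bad weight would reach the total weight [(1 + x) ^+ #|T|]. *)
exfalso; move: badt; rewrite ltNge => /negP; apply.
have -> : (1 + x) ^+ #|T| = \sum_(B : {set T}) x ^+ #|B|.
  by rewrite -cardsT -sum_expr_card_subset; apply: eq_bigl => B; rewrite subsetT.
under [leRHS]eq_bigr do under eq_bigr do rewrite big_mkcond /=.
under [leRHS]eq_bigr do rewrite exchange_big /=.
rewrite exchange_big /=; apply: ler_sum => B _.
have := nob B; rewrite negb_forall => /existsP[i].
rewrite negb_forall => /existsP[F]; rewrite negbK => badB.
rewrite (bigD1 i) //= (bigD1 F) //= badB -addrA lerDl addr_ge0 //.
  by apply: sumr_ge0 => ? _; case: ifP => // _; rewrite exprn_ge0.
by apply: sumr_ge0 => ? _; apply: sumr_ge0 => ? _; case: ifP => // _; rewrite exprn_ge0.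
Qed.

End Deletion.

(** * Cliques of K_n sharing an edge with a copy of G *)

Definition pairs (T : finType) (S : {set T}) : {set {set T}} :=
  [set e : {set T} | e \subset S & #|e| == 2].

Definition edges (V : finType) (G : rel V) : {set {set V}} :=
  [set e : {set V} | [exists x, exists y, G x y && (e == [set x; y])]].

Lemma leq_card_bigcup (I T : finType) (A : {pred I}) (F : I -> {set T}) :
  #|\bigcup_(i in A) F i| <= \sum_(i in A) #|F i|.
Proof.
elim/big_ind2: _ => [|? X ? Y leX leY|//]; first by rewrite cards0.
exact: leq_trans (leq_card_setU _ _) (leq_add leX leY).
Qed.

Lemma bin_le_expn (n k : nat) : 'C(n, k) <= n ^ k.
Proof.
apply: (@leq_trans (n ^_ k)); first by rewrite -bin_ffact leq_pmulr // fact_gt0.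
elim: k => // k IH; by rewrite ffactnSr expnSr leq_mul ?leq_subr.
Qed.

Lemma card_supersets_of_pair (n s : nat) (e : {set 'I_n}) : #|e| = 2 ->
  #|[set S : {set 'I_n} | (#|S| == s.+2) && (e \subset S)]| <= n ^ s.
Proof.
move=> ce; set D := finset _.
have <- : #|[set S :\: e | S in D]| = #|D|.
  apply: card_in_imset => S S'; rewrite !inE => /andP[_ eS] /andP[_ eS'] SS'.
  by rewrite -(setID S e) -(setID S' e) (setIidPr eS) (setIidPr eS') SS'.
apply: leq_trans (bin_le_expn n s); rewrite -[n in 'C(n, s)]card_ord -card_draws.
apply/subset_leq_card/subsetP => S' /imsetP[S]; rewrite !inE => /andP[/eqP cS eS] ->.
by rewrite cardsD (setIidPr eS) cS ce subn2.
Qed.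

(** This supplies the bound [M] of [random_deletion]: a clique touching [E] contains an edge of [E],
    and each edge lies in at most [n ^ s] cliques. *)
Lemma card_cliques_touching (n s : nat) (E : {set {set 'I_n}}) :
  #|[set K in [set pairs S | S : {set 'I_n} & #|S| == s.+2] | K :&: E != set0]|
    <= #|E| * n ^ s.
Proof.
pose F (e : {set 'I_n}) :=
  if #|e| == 2 then [set S : {set 'I_n} | (#|S| == s.+2) && (e \subset S)] else set0.
apply: (@leq_trans #|\bigcup_(e in E) F e|).
  apply: leq_trans (leq_imset_card (@pairs 'I_n) _).
  apply/subset_leq_card/subsetP => K; rewrite inE => /andP[/imsetP[S]].
  rewrite inE => cS -> /set0Pn[e]; rewrite !inE => /andP[/andP[eS ce] eE].
  by apply: imset_f; apply/bigcupP; exists e; rewrite // /F ce inE cS.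
apply: leq_trans (leq_card_bigcup _ _) _; rewrite -sum_nat_const.
apply: leq_sum => e _; rewrite /F; case: ifP => [/eqP|_]; last by rewrite cards0.
exact: card_supersets_of_pair.
Qed.

Section Lower.
Import all_order all_algebra.
Import Order.TTheory GRing.Theory Num.Theory.
Local Open Scope ring_scope.

(** Apply [random_deletion] to the cliques on [s.+2] vertices and to the images of [edges G] under
    injections. Coloured red, the resulting [B] contains no clique and meets every copy of [G]. *)
Lemma not_ramsey_prop (R : realFieldType) (s n : nat) (V : finType) (G : rel V) (x : R) :
  0 < x -> (#|V| <= n)%N ->
  n%:R ^+ n * (1 + x ^+ 'C(s.+2, 2)) ^+ (n_edges G * n ^ s) < (1 + x) ^+ n_edges G ->
  ~~ ramsey_prop s.+2 G n.
Proof.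
move=> x0 Vn small.
pose KK := [set pairs S | S : {set 'I_n} & #|S| == s.+2].
pose E (f : {ffun V -> 'I_n}) : {set {set 'I_n}} := [set f @: (e : {set V}) | e in edges G].
pose P (f : {ffun V -> 'I_n}) := injectiveb f.
have cE f : P f -> #|E f| = n_edges G.
  by move/injectiveP => finj; rewrite card_imset //; exact: imset_inj.
have [|K|f|f||B [B1 B2]] :=
  @random_deletion R _ _ P E KK 'C(s.+2, 2) (n_edges G) (n_edges G * n ^ s) x x0.
- by rewrite bin_gt0.
- by case/imsetP => S; rewrite inE => /eqP cS ->; rewrite cards_draws cS.
- exact: cE.
- by move/cE <-; exact: card_cliques_touching.
- apply: le_lt_trans small; rewrite ler_wpM2r ?exprn_ge0 ?addr_ge0 ?exprn_ge0 ?(ltW x0) //.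
  rewrite -natrX ler_nat; apply: leq_trans (max_card _) _.
  (* For [n = 0] the type [V] is empty, and both sides are [0 ^ 0]. *)
  rewrite card_ffun card_ord; case: n Vn {KK E P cE} => [|n] Vn.
    by move: Vn; rewrite leqn0 => /eqP ->.
  by rewrite leq_pexp2l.
apply/negP => /forallP /(_ B) /orP[] /existsP[f /andP[/injectiveP finj /forallP Hf]].
  pose S := [set f i | i : 'I_s.+2].
  have KS : pairs S \in KK.
    by apply: imset_f; rewrite inE card_imset // card_ord.
  have /negP[] := B1 _ KS; apply/subsetP => e; rewrite inE => /andP[/subsetP eS].
  case/cards2P => a [b [ab ee]]; rewrite {}ee in eS *.
  have /imsetP[i _ ai] := eS a (set21 _ _).
  have /imsetP[j _ bj] := eS b (set22 _ _).
  have /forallP/(_ j)/implyP := Hf i; rewrite -ai -bj; apply.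
  by apply: contra_neq ab => ij; rewrite ai bj ij.
have Pf : P f by apply/injectiveP.
have /set0Pn[e] := B2 f Pf; rewrite inE => /andP[eB /imsetP[e0]].
rewrite inE => /existsP[x1 /existsP[y1 /andP[Gxy /eqP ->]]] ee.
have /forallP/(_ y1)/implyP/(_ Gxy)/negP := Hf x1; apply.
by rewrite ee imsetU1 imset_set1 in eB.
Qed.

End Lower.

(** * Independent sets in locally sparse graphs *)

Definition nbhd (V : finType) (e : rel V) (v : V) : {set V} := [set u | e v u].

Definition indep (V : finType) (e : rel V) (S : {set V}) : bool :=
  [forall x in S, forall y in S, ~~ e x y].

Lemma indepP (V : finType) (e : rel V) (S : {set V}) :
  reflect {in S &, forall x y, ~~ e x y} (indep e S).
Proof.
apply: (iffP forall_inP) => [H x y xS yS | H x xS].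
  by move/forall_inP: (H x xS); apply.
by apply/forall_inP => y yS; apply: H.
Qed.

Lemma indepS (V : finType) (e : rel V) (S S' : {set V}) :
  S' \subset S -> indep e S -> indep e S'.
Proof.
move=> /subsetP SS /indepP H; apply/indepP => x y xS yS.
by apply: H; apply: SS.
Qed.

Section HardCore.
Import all_order all_algebra lra.
Import Order.TTheory GRing.Theory Num.Theory.
Local Open Scope ring_scope.
Variables (R : realFieldType) (V : finType) (e : rel V).
Hypotheses (e_irr : irreflexive e) (e_sym : symmetric e).
Variable eta : R.
Hypothesis eta_gt0 : 0 < eta.

Let eta_ge0 : 0 <= eta := ltW eta_gt0.

(* The partition function of the hard-core model on [X] at fugacity [eta]. *)
Definition hcZ (X : {set V}) : R :=
  \sum_(I : {set V} | (I \subset X) && indep e I) eta ^+ #|I|.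

Lemma hcZ0 : hcZ set0 = 1.
Proof.
rewrite /hcZ (big_pred1 set0) ?cards0 ?expr0 // => I.
rewrite /= subset0; case: eqP => [->|//] /=.
by apply/indepP => x y; rewrite inE.
Qed.

Lemma hcZ_mono (X Y : {set V}) : X \subset Y -> hcZ X <= hcZ Y.
Proof.
move=> XY; rewrite /hcZ big_mkcond [leRHS]big_mkcond /=.
apply: ler_sum => I _; case: ifP => [/andP[IX ->]|_].
  by rewrite (subset_trans IX XY).
by case: ifP => _ //; rewrite exprn_ge0.
Qed.

Lemma hcZ_ge1 (X : {set V}) : 1 <= hcZ X.
Proof. by rewrite -hcZ0 hcZ_mono // sub0set. Qed.

(** Removing [u] is a bijection onto the independent subsets of [X] that avoid [u] and its
    neighbours, at the cost of one factor [eta]. *)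
Lemma hcZ_mem (X : {set V}) (u : V) : u \in X ->
  \sum_(I : {set V} | (I \subset X) && indep e I && (u \in I)) eta ^+ #|I|
  = eta * hcZ (X :\: (u |: nbhd e u)).
Proof.
move=> uX; rewrite /hcZ mulr_sumr.
rewrite (reindex_onto (fun I => u |: I) (fun I => I :\ u)) /=; last first.
  by move=> I /andP[_ uI]; rewrite setD1K.
have uP (I : {set V}) : ((u |: I) :\ u == I) = (u \notin I).
  apply/eqP/idP => [<- | uI]; first by rewrite !inE eqxx.
  by rewrite setU1K.
rewrite (eq_bigl (fun I : {set V} => (I \subset X :\: (u |: nbhd e u)) && indep e I)).
  apply: eq_bigr => I /andP[/subsetP IX _].
  rewrite cardsU1 exprD (_ : u \notin I) ?expr1 //.
  by apply/negP => /IX; rewrite !inE eqxx.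
move=> I; rewrite uP setU11 andbT subUset sub1set uX /=.
apply/andP/andP => [[/andP[IX indI] uI] | [/subsetP IX indI]].
  split; last exact: indepS (subsetUr _ _) indI.
  apply/subsetP => w wI; rewrite !inE (subsetP IX) // andbT negb_or.
  apply/andP; split; first by apply: contraNneq uI => <-.
  by move/indepP: indI => /(_ u w); apply; rewrite !inE ?eqxx // wI orbT.
have IX' w : w \in I -> [/\ w != u, ~~ e u w & w \in X].
  by move/IX; rewrite !inE negb_or => /andP[/andP[-> ->] ->].
split; last by apply/negP => /IX'; rewrite eqxx; case.
apply/andP; split; first by apply/subsetP => w /IX'[].
apply/indepP => a c; rewrite !inE.
case/predU1P => [->|aI]; case/predU1P => [->|cI]; rewrite ?e_irr //.
- by case: (IX' _ cI).
- by rewrite e_sym; case: (IX' _ aI).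
- by move/indepP: indI; apply.
Qed.

Lemma hcZ_del1 (X : {set V}) (y : V) : hcZ X <= (1 + eta) * hcZ (X :\ y).
Proof.
have H1 : hcZ (X :\ y) <= (1 + eta) * hcZ (X :\ y).
  by rewrite ler_peMl ?lerDl // (le_trans ler01 (hcZ_ge1 _)).
have [yX | yX] := boolP (y \in X); last first.
  by rewrite (_ : X :\ y = X) in H1 *; last by apply/setDidPl; rewrite disjoint_sym disjoints1.
rewrite {1}/hcZ (bigID (fun I : {set V} => y \in I)) /= hcZ_mem //.
rewrite mulrDl mul1r addrC lerD //.
  rewrite le_eqVlt; apply/orP; left; apply/eqP; apply: eq_bigl => I.
  by rewrite subsetD1 -!andbA [(y \notin I) && _]andbC.
rewrite ler_wpM2l // hcZ_mono //; apply/subsetP => w; rewrite !inE negb_or.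
by case/andP=> [/andP[-> _] ->].
Qed.

Lemma hcZ_del (B X : {set V}) : hcZ X <= (1 + eta) ^+ #|B| * hcZ (X :\: B).
Proof.
have [k leBk] := ubnP #|B|; elim: k B X leBk => // k IH B X.
have [-> | [y yB]] := set_0Vmem B; first by rewrite setD0 cards0 mul1r.
rewrite (cardsD1 y B) yB add1n !ltnS => leB.
apply: le_trans (hcZ_del1 X y) _; rewrite exprS -mulrA ler_wpM2l ?addr_ge0 //.
apply: le_trans (IH (B :\ y) _ leB) _.
by rewrite setDDl setD1K.
Qed.

Lemma hcZ_le (X : {set V}) : hcZ X <= (1 + eta) ^+ #|X|.
Proof. by have := hcZ_del X X; rewrite setDv hcZ0 mulr1. Qed.

(** By [hcZ_mem], the weight of the sets containing [u] is [eta] times the partition function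
    without the closed neighbourhood of [u]. By [hcZ_del], that deletion costs at most a factor [K].
    Sum over [u]. *)
Lemma hcZ_mean (X : {set V}) (K : R) :
  (forall u, u \in X -> (1 + eta) ^+ (#|nbhd e u :&: X|.+1) <= K) ->
  eta * #|X|%:R * hcZ X <=
  K * \sum_(I : {set V} | (I \subset X) && indep e I) eta ^+ #|I| * #|I|%:R.
Proof.
move=> HK.
have -> : \sum_(I : {set V} | (I \subset X) && indep e I) eta ^+ #|I| * #|I|%:R
   = \sum_(u in X) eta * hcZ (X :\: (u |: nbhd e u)).
  rewrite (eq_bigr (fun I : {set V} => \sum_(u in X) (if u \in I then eta ^+ #|I| else 0))).
    rewrite exchange_big /=; apply: eq_bigr => u uX.
    by rewrite -big_mkcondr /= hcZ_mem.
  move=> I /andP[IX _]; rewrite -big_mkcondr /= sumr_const mulr_natr.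
  congr (_ *+ _); apply: eq_card => u; rewrite -[RHS]/((u \in X) && (u \in I)).
  by case: (boolP (u \in I)) => [/(subsetP IX) ->|]; rewrite ?andbF.
have -> : eta * #|X|%:R * hcZ X = \sum_(u in X) eta * hcZ X.
  by rewrite sumr_const mulrAC mulr_natr.
rewrite mulr_sumr; apply: ler_sum => u uX.
rewrite mulrCA ler_wpM2l //.
have -> : X :\: (u |: nbhd e u) = X :\: (u |: (nbhd e u :&: X)).
  by apply/setP => w; rewrite !inE; case: (w \in X); rewrite ?andbF ?andbT.
apply: le_trans (hcZ_del (u |: (nbhd e u :&: X)) X) _.
rewrite ler_wpM2r ?(le_trans ler01 (hcZ_ge1 _)) //.
by rewrite cardsU1 !inE e_irr add1n HK.
Qed.

(** Fix the part [W0] of [W] outside the closed neighbourhood [C] of [v]. The rest of [W] is then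
    either [[set v]] or an independent subset of the neighbours of [v] left free by [W0], so each
    class reduces to one inequality in the number and the partition function of these free
    neighbours. *)
Lemma local_occupancy (A : {set V}) (v : V) (d K L : R) :
  v \in A -> 0 < K ->
  (forall u, u \in nbhd e v :&: A ->
     (1 + eta) ^+ #|nbhd e u :&: nbhd e v :&: A|.+1 <= K) ->
  (forall (x : nat) (Z : R), 1 <= Z -> Z <= (1 + eta) ^+ x ->
     L * (eta + Z) <= d * eta + eta * x%:R * Z / K) ->
  0 <= \sum_(W : {set V} | (W \subset A) && indep e W)
         eta ^+ #|W| * (d *+ (v \in W) + #|nbhd e v :&: W|%:R - L).
Proof.
move=> vA K0 codeg HL.
pose C := v |: nbhd e v.
pose g (W : {set V}) : R := d *+ (v \in W) + #|nbhd e v :&: W|%:R - L.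
rewrite -/g (partition_big (fun W : {set V} => W :\: C)
  (fun W0 => (W0 \subset A :\: C) && indep e W0)) /=; last first.
  move=> W /andP[WA indW]; rewrite setSD //=.
  exact: indepS (subsetDl _ _) indW.
apply: sumr_ge0 => W0 /andP[/subsetP W0A indW0].
rewrite (reindex_onto (fun I => W0 :|: I) (fun W => W :&: C)) /=; last first.
  by move=> W /andP[_ /eqP <-]; rewrite setUC setID.
have W0P w : w \in W0 -> [/\ w \in A, w != v & ~~ e v w].
  by move/W0A; rewrite !inE negb_or => /andP[/andP[-> ->] ->].
(* The neighbours of [v] in [A] that [W0] does not block; [W0] itself never blocks [v]. *)
pose X := [set w in A | e v w && [forall u in W0, ~~ e u w]].
have XP w : w \in X -> [/\ w \in A, e v w & forall u, u \in W0 -> ~~ e u w].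
  by rewrite !inE => /and3P[-> -> /forall_inP].
rewrite (eq_bigl (fun I : {set V} => (I \subset v |: X) && indep e I)); last first.
  move=> I; apply/idP/idP.
    case/andP=> /andP[/andP[WA indW] /eqP dW] /eqP iW.
    rewrite (indepS (subsetUr _ _) indW) andbT; apply/subsetP => w wI.
    have : w \in C by move: wI; rewrite -iW inE => /andP[].
    rewrite !inE => /orP[-> //| evw]; apply/orP; right.
    rewrite evw (subsetP WA) ?inE ?wI ?orbT //=.
    by apply/forall_inP => u uW; move/indepP: indW; apply; rewrite inE ?uW ?wI ?orbT.
  case/andP=> /subsetP IY indI.
  have IP w : w \in I -> w \in C.
    by move/IY; rewrite !inE => /orP[-> //|/and3P[_ -> _]]; rewrite orbT.
  have IA w : w \in I -> w \in A.
    by move/IY; rewrite !inE => /orP[/eqP -> //|/and3P[]].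
  have IW u w : u \in W0 -> w \in I -> ~~ e u w.
    move=> uW /IY; rewrite !inE => /orP[/eqP ->|/and3P[_ _ /forall_inP]]; last exact.
    by rewrite e_sym; case: (W0P _ uW).
  have WC w : w \in W0 -> w \notin C by move/W0A; rewrite inE => /andP[].
  apply/andP; split; [apply/andP; split; [apply/andP; split|]|].
  - by apply/subsetP => w; rewrite inE => /orP[/W0P[]|/IA].
  - apply/indepP => a b; rewrite !inE => /orP[aW|aI] /orP[bW|bI].
    + by move/indepP: indW0; apply.
    + exact: IW.
    + by rewrite e_sym IW.
    + by move/indepP: indI; apply.
  - apply/eqP/setP => w; rewrite in_setD in_setU.
    case: (boolP (w \in W0)) => [/WC -> //|_] /=.
    by case: (boolP (w \in I)) => [/IP ->|]; rewrite ?andbF.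
  - apply/eqP/setP => w; rewrite in_setI in_setU.
    case: (boolP (w \in I)) => [/IP ->|_]; rewrite ?orbT ?orbF //.
    by case: (boolP (w \in W0)) => [/WC /negPf ->|].
have vX : v \notin X by rewrite !inE e_irr andbF.
rewrite (eq_bigr (fun I : {set V} => eta ^+ #|W0| * (eta ^+ #|I| * g I))); last first.
  move=> I /andP[/subsetP IY _]; rewrite mulrA -exprD cardsU.
  have -> : W0 :&: I = set0.
    apply/setP => w; rewrite !inE; apply/negP => /andP[/W0P[_ nwv nevw] /IY].
    by rewrite !inE (negPf nwv) (negPf nevw) !andbF.
  rewrite cards0 subn0; congr (_ * _); rewrite /g inE.
  have -> : (v \in W0) = false by apply/negP => /W0P[_]; rewrite eqxx.
  rewrite setIUr; have -> : nbhd e v :&: W0 = set0; last by rewrite set0U.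
  by apply/setP => w; rewrite !inE; apply/negP => /andP[evw /W0P[_ _]]; rewrite evw.
rewrite -mulr_sumr mulr_ge0 ?exprn_ge0 //.
(* As [v] is adjacent to all of [X], the only completion containing [v] is [[set v]]. *)
rewrite (bigID (fun I : {set V} => v \in I)) /= (big_pred1 [set v]); last first.
  move=> I; rewrite -andbA; apply/and3P/eqP => [[/subsetP IY /indepP indI vI]|->].
    apply/setP => w; rewrite inE; apply/idP/eqP => [wI | -> //].
    have := IY _ wI; rewrite in_setU1 => /orP[/eqP //|/XP[_ evw _]].
    by have := indI _ _ vI wI; rewrite evw.
  rewrite sub1set !inE eqxx; split=> //.
  by apply/indepP => a b; rewrite !inE => /eqP -> /eqP ->; rewrite e_irr.
rewrite cards1 expr1 /g inE eqxx.
have -> : nbhd e v :&: [set v] = set0.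
  by apply/setP => w; rewrite !inE; case: eqP => [->|]; rewrite ?e_irr ?andbF.
rewrite cards0 addr0.
rewrite (eq_bigl (fun I : {set V} => (I \subset X) && indep e I)); last first.
  move=> I; rewrite andbAC; congr (_ && _).
  apply/andP/idP => [[/subsetP IY vI] | IX].
    apply/subsetP => w wI; have := IY _ wI; rewrite in_setU1 => /orP[/eqP wv|//].
    by rewrite -wv wI in vI.
  by split; [exact: subset_trans IX (subsetUr _ _) | apply: contra vX; apply/subsetP].
rewrite (eq_bigr (fun I : {set V} => eta ^+ #|I| * #|I|%:R - L * eta ^+ #|I|)); last first.
  move=> I /andP[/subsetP IX _].
  have -> : nbhd e v :&: I = I.
    by apply/setIidPr/subsetP => w /IX /XP[_ evw _]; rewrite inE.
  have -> : (v \in I) = false by apply/negP => /IX; apply/negP.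
  by rewrite mulr0n add0r mulrBr [L * _]mulrC.
rewrite big_split /= sumrN -mulr_sumr -/(hcZ X) mulr1n.
have XN : X \subset nbhd e v :&: A.
  by apply/subsetP => w /XP[wA evw _]; rewrite !inE evw.
have mean : eta * #|X|%:R * hcZ X / K <=
   \sum_(I : {set V} | (I \subset X) && indep e I) eta ^+ #|I| * #|I|%:R.
  rewrite ler_pdivrMr // [leRHS]mulrC; apply: hcZ_mean => u uX.
  apply: le_trans (codeg u _); last exact: (subsetP XN).
  rewrite ler_weXn2l ?lerDl // ltnS; apply: subset_leq_card.
  by rewrite -setIA setIS.
(* The class contributes [eta * (d - L)] from [[set v]], and from the subsets of [X] at least
   [eta * #|X| * hcZ X / K - L * hcZ X]. *)
have := HL #|X| (hcZ X) (hcZ_ge1 X) (hcZ_le X).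
lra.
Qed.

(* Each v lets the random W see d [v in W] + #|N(v) :&: W| >= L on average, while
   summing this quantity over v counts every element of W at most 2 d times. *)
Theorem indep_of_locally_sparse (A : {set V}) (d K L : R) :
  0 < K ->
  (forall v, v \in A -> #|nbhd e v :&: A|%:R <= d) ->
  (forall u v, v \in A -> u \in nbhd e v :&: A ->
     (1 + eta) ^+ #|nbhd e u :&: nbhd e v :&: A|.+1 <= K) ->
  (forall (x : nat) (Z : R), 1 <= Z -> Z <= (1 + eta) ^+ x ->
     L * (eta + Z) <= d * eta + eta * x%:R * Z / K) ->
  exists W : {set V}, [/\ W \subset A, indep e W & L * #|A|%:R <= 2%:R * d * #|W|%:R].
Proof.
move=> K0 deg codeg HL.
pose h (W : {set V}) : R :=
  \sum_(v in A) (d *+ (v \in W) + #|nbhd e v :&: W|%:R - L).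
have Hsum : 0 <= \sum_(W : {set V} | (W \subset A) && indep e W) eta ^+ #|W| * h W.
  under eq_bigr do rewrite mulr_sumr.
  rewrite exchange_big /=; apply: sumr_ge0 => v vA.
  apply: (@local_occupancy A v d K L) => //; move=> u; exact: codeg.
have [W /andP[WA indW] hW] : exists2 W : {set V}, (W \subset A) && indep e W & 0 <= h W.
  case: (boolP [exists W : {set V}, (W \subset A) && indep e W && (0 <= h W)]).
    by case/existsP => W /andP[? ?]; exists W.
  rewrite negb_exists => /forallP noW; exfalso; move: Hsum; rewrite leNgt => /negP; apply.
  (* The empty set guarantees one term, so that the sum of negative terms is strictly negative. *)
  have ind0 : (set0 \subset A) && indep e set0.
    by rewrite sub0set; apply/indepP => ? ?; rewrite inE.
  have neg (W : {set V}) : (W \subset A) && indep e W -> eta ^+ #|W| * h W < 0.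
    move=> WI; have := noW W; rewrite WI /= -ltNge => hW.
    by rewrite pmulr_rlt0 // exprn_gt0.
  rewrite (bigD1 set0) //= -[ltRHS]addr0 ltr_leD ?neg //.
  by apply: sumr_le0 => W /andP[/neg /ltW].
exists W; split=> //; move: hW; rewrite /h.
rewrite big_split /= sumr_const big_split /=.
have -> : \sum_(v in A) d *+ (v \in W) = d * #|W|%:R.
  rewrite (eq_bigr (fun v => if v \in W then d else 0)); last by move=> v _; case: (v \in W).
  rewrite -big_mkcondr /= sumr_const mulr_natr; congr (_ *+ _); apply: eq_card => v.
  rewrite -[LHS]/((v \in A) && (v \in W)).
  by case: (boolP (v \in W)) => [/(subsetP WA) ->|]; rewrite ?andbF.
have : \sum_(v in A) (#|nbhd e v :&: W|%:R : R) <= d * #|W|%:R.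
  rewrite (eq_bigr (fun v => \sum_(w in W) (if e v w then 1 else 0))); last first.
    move=> v _; rewrite -big_mkcondr /= sumr_const; congr (_ *+ _).
    by apply: eq_card => w; rewrite !inE andbC.
  rewrite exchange_big /= mulr_natr -sumr_const; apply: ler_sum => w wW.
  apply: le_trans (deg w (subsetP WA _ wW)).
  rewrite -big_mkcondr /= sumr_const le_eqVlt; apply/orP; left; apply/eqP; congr (_ *+ _).
  by apply: eq_card => v; rewrite !inE andbC e_sym.
rewrite -mulr_natr; lra.
Qed.

End HardCore.

(** * Cliques, greedy extraction and the graph of part (ii) *)

Definition clique (V : finType) (e : rel V) (S : {set V}) : bool :=
  [forall x in S, forall y in S, (x != y) ==> e x y].

Lemma cliqueP (V : finType) (e : rel V) (S : {set V}) :
  reflect {in S &, forall x y, x != y -> e x y} (clique e S).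
Proof.
apply: (iffP forall_inP) => [H x y xS yS | H x xS].
  by move/forall_inP: (H x xS) => /(_ y yS) /implyP.
by apply/forall_inP => y yS; apply/implyP; apply: H.
Qed.

(** Adding [v] to a clique among its neighbours gives a larger clique. *)
Lemma clique_nbhd (V : finType) (e : rel V) (A : {set V}) (k : nat) (v : V) :
  irreflexive e -> symmetric e ->
  (forall S : {set V}, S \subset A -> clique e S -> (#|S| <= k.+1)%N) ->
  v \in A ->
  forall S : {set V}, S \subset nbhd e v :&: A -> clique e S -> (#|S| <= k)%N.
Proof.
move=> eirr esym HA vA S /subsetP SN /cliqueP clS.
have evS x : x \in S -> e v x by move/SN; rewrite !inE => /andP[].
have vS : v \notin S by apply/negP => /evS; rewrite eirr.
have := HA (v |: S); rewrite cardsU1 vS ltnS; apply.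
  by rewrite subUset sub1set vA; apply/subsetP => x /SN; rewrite inE => /andP[].
apply/cliqueP => x y; rewrite !inE.
case/predU1P => [->|xS]; case/predU1P => [->|yS]; rewrite ?eqxx //.
- by rewrite evS.
- by rewrite esym evS.
- exact: clS.
Qed.

Lemma exists_subset_card (T : finType) (A : {set T}) (m : nat) :
  (m <= #|A|)%N -> exists2 B : {set T}, B \subset A & #|B| = m.
Proof.
rewrite -bin_gt0 -cards_draws card_gt0 => /set0Pn[B].
by rewrite inE => /andP[BA /eqP cB]; exists B.
Qed.

(** Greedy choice: until [j] sets of size [t] have been removed, at least [F] vertices remain. *)
Lemma disjoint_indep_sets (V : finType) (e : rel V) (t F j : nat) (A : {set V}) :
  (forall A' : {set V}, (F <= #|A'|)%N ->
     exists S : {set V}, [/\ S \subset A', indep e S & #|S| = t]) ->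
  (F + j * t <= #|A|)%N ->
  exists g : nat -> {set V},
    (forall a, (a < j)%N -> [/\ g a \subset A, indep e (g a) & #|g a| = t]) /\
    (forall a b, (a < j)%N -> (b < j)%N -> a != b -> [disjoint g a & g b]).
Proof.
move=> HF; elim: j A => [|j IH] A; first by exists (fun=> set0).
move=> cA.
have [|S [SA iS cS]] := HF A; first by apply: leq_trans cA; rewrite leq_addr.
have [|g [g1 g2]] := IH (A :\: S).
  rewrite cardsD (setIidPr SA) cS leq_subRL -?cS ?subset_leq_card // addnCA cS.
  by rewrite mulSn in cA.
exists (fun a => if a is a'.+1 then g a' else S); split.
  case=> [|a] //; rewrite ltnS => /g1[gA ? ?]; split=> //.
  by apply: subset_trans gA (subsetDl _ _).
have dis a : (a < j)%N -> [disjoint S & g a].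
  by case/g1 => + _ _; rewrite subsetD disjoint_sym => /andP[].
case=> [|a] [|b] //; rewrite ?ltnS ?eqSS => aj bj ab.
- exact: dis.
- by rewrite disjoint_sym dis.
- exact: g2.
Qed.

(** [Red] may contain singletons [[set i; i]], so loops are excluded explicitly. *)
Definition red_rel (n : nat) (Red : {set {set 'I_n}}) : rel 'I_n :=
  fun i j => (i != j) && ([set i; j] \in Red).

Lemma red_rel_irr n (Red : {set {set 'I_n}}) : irreflexive (red_rel Red).
Proof. by move=> i; rewrite /red_rel eqxx. Qed.

Lemma red_rel_sym n (Red : {set {set 'I_n}}) : symmetric (red_rel Red).
Proof. by move=> i j; rewrite /red_rel eq_sym setUC. Qed.

Lemma card_red_clique (s n : nat) (Red : {set {set 'I_n}}) (S : {set 'I_n}) :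
  ~~ has_red_Ks s.+1 Red -> clique (red_rel Red) S -> (#|S| <= s)%N.
Proof.
move=> noK /cliqueP clS; rewrite leqNgt; apply: contra noK => sS.
pose f := [ffun i : 'I_s.+1 => enum_val (widen_ord sS i)].
have finj : injective f.
  by move=> i i'; rewrite !ffunE => /enum_val_inj /(congr1 val) /= /val_inj.
apply/existsP; exists f; apply/andP; split; first exact/injectiveP.
apply/forallP => i; apply/forallP => i'; apply/implyP => ii'.
have := clS (f i) (f i'); rewrite !ffunE !enum_valP => /(_ isT isT).
rewrite -!(ffunE (fun i => enum_val (widen_ord sS i))) -/f.
by rewrite (inj_eq finj) => /(_ ii')/andP[].
Qed.

Lemma ramsey_le (s : nat) (V : finType) (G : rel V) (n : nat) :
  ramsey_prop s G n -> (ramsey s G <= n)%N.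
Proof.
move=> Gn; rewrite /ramsey.
case: excluded_middle_informative => [h | []]; last by exists n.
by case: ex_minnP => r _; apply.
Qed.

Lemma ramsey_propP (s : nat) (V : finType) (G : rel V) :
  (exists n, ramsey_prop s G n) -> ramsey_prop s G (ramsey s G).
Proof.
move=> ex; rewrite /ramsey; case: excluded_middle_informative => [h | //].
by case: ex_minnP.
Qed.

(** Any [m] of the edges of [j] disjoint copies of K_t will do; the first coordinate of a vertex
    names its copy. *)
Lemma disjoint_cliques_subgraph (j t m : nat) :
  (m <= j * 'C(t, 2))%N ->
  exists G : rel ('I_j * 'I_t),
    [/\ simple_graph G, n_edges G = m & forall x y, G x y -> x.1 = y.1].
Proof.
move=> mle.
pose E0 := [set e : {set 'I_j * 'I_t} |
             (#|e| == 2) && [forall x in e, forall y in e, x.1 == y.1]].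
pose lft (a : 'I_j) (B : {set 'I_t}) := [set (a, b) | b in B].
have linj (a : 'I_j) : injective (fun b : 'I_t => (a, b)) by move=> b b' [].
have E0card : (j * 'C(t, 2) <= #|E0|)%N.
  pose D := setX [set: 'I_j] [set B : {set 'I_t} | #|B| == 2].
  have <- : #|[set lft p.1 p.2 | p in D]| = (j * 'C(t, 2))%N.
    rewrite card_in_imset ?cardsX ?cardsT ?card_draws ?card_ord //.
    case=> a B [a' B'] /=; rewrite !inE /= => /eqP cB /eqP cB' eqBB.
    have /card_gt0P[b bB] : (0 < #|B|)%N by rewrite cB.
    have : (a, b) \in lft a' B' by rewrite -eqBB; apply: imset_f.
    case/imsetP => b' _ [aa _]; rewrite -aa in eqBB *.
    by rewrite (imset_inj (@linj a) eqBB).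
  apply/subset_leq_card/subsetP => e /imsetP[[a B]]; rewrite !inE /= => cB ->.
  rewrite card_imset // cB /=.
  by apply/forall_inP => x /imsetP[b _ ->]; apply/forall_inP => y /imsetP[b' _ ->].
have [S SE cS] := exists_subset_card (leq_trans mle E0card).
exists (fun x y => (x != y) && ([set x; y] \in S)); split.
- by split=> [x | x y]; [rewrite eqxx | rewrite eq_sym setUC].
- rewrite -cS; apply: eq_card => e; rewrite inE; apply/existsP/idP.
    by case=> x /existsP[y /andP[/andP[_ xyS] /eqP ->]].
  move=> eS; have := subsetP SE _ eS; rewrite inE => /andP[/cards2P[x [y [xy ee]]] _].
  by exists x; apply/existsP; exists y; rewrite xy -ee eS eqxx.
- move=> x y /andP[_ /(subsetP SE)]; rewrite inE => /andP[_ /forall_inP H].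
  by apply/eqP; move/forall_inP: (H x (set21 _ _)); apply; exact: set22.
Qed.

(** The colouring without red edges has no red clique on two or more vertices, so [G] must embed. *)
Lemma ramsey_prop_card (s n : nat) (V : finType) (G : rel V) :
  ramsey_prop s.+2 G n -> #|V| <= n.
Proof.
move/forallP/(_ set0)/orP => [] /existsP[f /andP[/injectiveP finj Hf]].
  have /forallP/(_ ord0)/forallP/(_ ord_max)/implyP := Hf.
  by rewrite inE => /(_ isT).
by rewrite -[n]card_ord -(card_codom finj) max_card.
Qed.

Lemma n_edges_card (V : finType) (G : rel V) : 0 < n_edges G -> 0 < #|V|.
Proof.
case/card_gt0P => e; rewrite inE => /existsP[x _]; by apply/card_gt0P; exists x.
Qed.

Local Open Scope R_scope.

(** * Bounds over the reals *)

Lemma exp_le (x y : R) : x <= y -> exp x <= exp y.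
Proof.
by case=> [lt_xy | ->]; [left; exact: exp_increasing | right].
Qed.

Lemma ln_le (x y : R) : 0 < x -> x <= y -> ln x <= ln y.
Proof.
by move=> x0; case=> [lt_xy | ->]; [left; exact: ln_increasing | right].
Qed.

Lemma pow_1_plus_le_exp (x : R) (n : nat) : 0 <= x -> (1 + x) ^ n <= exp (x * INR n).
Proof.
move=> x0; elim: n => [|n IH]; first by rewrite Rmult_0_r exp_0; right.
rewrite S_INR (_ : x * (INR n + 1) = x + x * INR n); last by ring.
rewrite exp_plus; apply: Rmult_le_compat IH; [lra | apply: pow_le; lra |].
exact: exp_ineq1_le.
Qed.

Section Transfer.
Import all_algebra Rstruct.

Lemma indep_of_locally_sparse_log (V : finType) (e : rel V) (A : {set V}) (d lam : R) :
  irreflexive e -> symmetric e -> 0 <= lam -> lam + 1 <= d ->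
  (forall v, v \in A -> INR #|nbhd e v :&: A| <= d) ->
  (forall u v, v \in A -> u \in nbhd e v :&: A ->
     INR #|nbhd e u :&: nbhd e v :&: A| <= lam) ->
  exists W : {set V},
    [/\ W \subset A, indep e W & ln (d / (lam + 1)) * INR #|A| <= 16 * d * INR #|W|].
Proof.
move=> eirr esym lam0 lamd deg codeg.
(* With this [eta], [(1 + eta) ^ (lam + 1)] is at most e, whence [K = 3]. The 8 in [L] makes
   [d * eta = exp (8 * L)], large enough to absorb [2 * L * exp (6 * L)]. *)
set D := d / (lam + 1); set eta := / (lam + 1); set L := ln D / 8.
have eta0 : 0 < eta by apply: Rinv_0_lt_compat; lra.
have etalam : eta * (lam + 1) = 1 by rewrite /eta; field; lra.
have eta1 : eta <= 1 by nra.
have D1 : 1 <= D by rewrite /D /Rdiv -/eta; nra.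
have L0 : 0 <= L.
  rewrite /L; suff : 0 <= ln D by lra.
  by rewrite -ln_1; apply: ln_le; lra.
have eD : exp (8 * L) = D.
  by rewrite /L (_ : 8 * (ln D / 8) = ln D); [rewrite exp_ln; lra | field].
have three_gt0 : 0 < 3 by lra.
have HL x Z : 1 <= Z -> Z <= (1 + eta) ^ x ->
   L * (eta + Z) <= d * eta + eta * INR x * Z / 3.
  move=> Z1 Zx.
  have {}Zx : Z <= exp (eta * INR x).
    by apply: Rle_trans Zx _; apply: pow_1_plus_le_exp; lra.
  have x0 := pos_INR x.
  have y0 : 0 <= eta * INR x by nra.
  have dD : d * eta = D by [].
  (* If [eta * x >= 6 * L], the last term alone is at least [2 * L * Z]. Otherwise
     [Z <= exp (6 * L)], and [d * eta] suffices. *)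
  have [big | small] := Rle_lt_dec (6 * L) (eta * INR x).
    have : 2 * L * Z <= eta * INR x * Z / 3 by nra.
    have : L * (eta + Z) <= 2 * L * Z by nra.
    by rewrite dD; lra.
  have Z6 : Z <= exp (6 * L).
    apply: Rle_trans Zx _; apply: exp_le; lra.
  have : L * (eta + Z) <= 2 * L * exp (6 * L) by nra.
  have : 2 * L * exp (6 * L) <= D.
    rewrite -eD (_ : 8 * L = 2 * L + 6 * L); last by ring.
    rewrite exp_plus; apply: Rmult_le_compat_r; first exact: Rlt_le (exp_pos _).
    by have := exp_ineq1_le (2 * L); lra.
  have : 0 <= eta * INR x * Z / 3 by nra.
  by rewrite dD; lra.
have [|||||W [WA indW HW]] :=
  @indep_of_locally_sparse _ V e eirr esym eta _ A d 3 L.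
- exact/RltP.
- by apply/RltP; exact: three_gt0.
- by move=> v vA; apply/RleP; rewrite -INRE; exact: deg.
- move=> u v vA uA; apply/RleP; rewrite -RpowE.
  apply: Rle_trans (pow_1_plus_le_exp _ _) _; first lra.
  apply: Rle_trans _ exp_le_3.
  rewrite S_INR; have := codeg u v vA uA => H.
  have : eta * (INR #|nbhd e u :&: nbhd e v :&: A| + 1) <= 1 by nra.
  exact: exp_le.
- move=> x Z /RleP Z1 /RleP; rewrite -RpowE => Zx.
  by apply/RleP; rewrite -INRE; exact: HL.
exists W; split=> //; move/RleP: HW; rewrite -!INRE => HW.
have {HW} : L * INR #|A| <= 2 * d * INR #|W| by [].
by rewrite /L; lra.
Qed.

Lemma not_ramsey_prop_INR (s n : nat) (V : finType) (G : rel V) (x : R) :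
  0 < x -> (#|V| <= n)%N ->
  INR n ^ n * (1 + x ^ 'C(s.+2, 2)) ^ (n_edges G * n ^ s) < (1 + x) ^ n_edges G ->
  ~~ ramsey_prop s.+2 G n.
Proof.
move=> /RltP x0 Vn Hx; apply: (not_ramsey_prop x0 Vn); apply/RltP.
by rewrite -INRE -!RpowE.
Qed.

End Transfer.

(** * Elementary estimates and the Ajtai-Komlos-Szemeredi bound *)

Lemma ln_lt_self (x : R) : 0 < x -> ln x < x.
Proof.
move=> x0; have := exp_ineq1_le (ln x); rewrite exp_ln //; lra.
Qed.

(** exp u is at least (1 + u/2)^2 = 2u + (1 - u/2)^2. *)
Lemma double_le_exp (u : R) : 0 <= u -> 2 * u <= exp u.
Proof.
move=> u0; rewrite (_ : u = u / 2 + u / 2); last by field.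
rewrite exp_plus; have := exp_ineq1_le (u / 2) => H.
have : (1 + u / 2) * (1 + u / 2) <= exp (u / 2) * exp (u / 2).
  by apply: Rmult_le_compat; lra.
have := Rle_0_sqr (1 - u / 2); rewrite /Rsqr; lra.
Qed.

Lemma ln_ratio_bounds (t : nat) : (2 <= t)%N ->
  [/\ 2 <= INR t, / 2 < ln (INR t) & 1 <= INR t / ln (INR t)].
Proof.
move=> t2; have t2' : 2 <= INR t by apply: (le_INR 2); apply/leP.
  have l2 : / 2 < ln (INR t).
  by apply: Rlt_le_trans ln_lt_2 _; apply: ln_le; lra.
  split=> //; have lt := @ln_lt_self (INR t).
  by apply: (Rmult_le_reg_r (ln (INR t))); [lra | field_simplify; lra].
Qed.

(* Ajtai-Komlos-Szemeredi: r(K_(k+1), K_t) = O(t ^ k / (ln t) ^ (k - 1)). *)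
Theorem clique_indep_bound (k : nat) :
  exists C : R, 0 < C /\
    forall (t : nat) (V : finType) (e : rel V) (A : {set V}),
      (2 <= t)%N -> irreflexive e -> symmetric e ->
      (forall S : {set V}, S \subset A -> clique e S -> (#|S| <= k)%N) ->
      (forall S : {set V}, S \subset A -> indep e S -> (#|S| <= t)%N) ->
      INR #|A| <= C * (INR t / ln (INR t)) ^ k * ln (INR t).
Proof.
pose P k := exists C : R, 0 < C /\
    forall (t : nat) (V : finType) (e : rel V) (A : {set V}),
      (2 <= t)%N -> irreflexive e -> symmetric e ->
      (forall S : {set V}, S \subset A -> clique e S -> (#|S| <= k)%N) ->
      (forall S : {set V}, S \subset A -> indep e S -> (#|S| <= t)%N) ->
      INR #|A| <= C * (INR t / ln (INR t)) ^ k * ln (INR t).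
(* Two consecutive cases are carried along: for cliques of size at most [k.+2], degrees are bounded
   by the case [k.+1] and codegrees by the case [k]. *)
suff : P k /\ P k.+1 by case.
elim: k => [|k [[C0 [C00 IH0]] [C1 [C10 IH1]]]].
  split; exists 1; split; try lra.
    move=> t V e A t2 eirr esym cl _; have [T1 T2 T3] := ln_ratio_bounds t2.
    have -> : #|A| = 0%N.
      apply/eqP; rewrite cards_eq0; apply: contraT => /set0Pn[x xA].
      have := cl [set x]; rewrite cards1 sub1set => /(_ xA); apply.
      by apply/cliqueP => a b; rewrite !inE => /eqP -> /eqP ->; rewrite eqxx.
    rewrite /=; lra.
  move=> t V e A t2 eirr esym cl ind; have [T1 T2 T3] := ln_ratio_bounds t2.
  have -> : 1 * (INR t / ln (INR t)) ^ 1 * ln (INR t) = INR t by field; lra.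
  apply: le_INR; apply/leP; apply: ind => //.
  apply/indepP => x y xA yA; apply/negP => exy.
  have xy : x != y by apply: contraTneq exy => ->; rewrite eirr.
  suff : (#|[set x; y]| <= 1)%N by rewrite cards2 xy.
  apply: cl; first by rewrite subUset !sub1set xA.
  apply/cliqueP => a b; rewrite !inE.
  by do 2![case/orP=> /eqP ->]; rewrite ?eqxx // esym.
split; first by exists C1.
(* [C1] makes [d] a degree bound. Since [q ^ k * l >= 1/2], the summand [C0 + 2] gives
   [q * (lam + 1) <= d]. The 32 is 16 times the 2 lost in [lD]. *)
pose C1' := C1 + C0 + 2; exists (32 * C1'); split; first by rewrite /C1'; lra.
move=> t V e A t2 eirr esym cl ind; have [T1 T2 T3] := ln_ratio_bounds t2.
set q := INR t / ln (INR t) in T3 *; set l := ln (INR t) in T2 *.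
have qk : 1 <= q ^ k by apply: pow_R1_Rle.
have ql : / 2 <= q ^ k * l by nra.
pose lam := C0 * q ^ k * l; pose d := C1' * q ^ k.+1 * l.
have lam0 : 0 <= lam by rewrite /lam Rmult_assoc; nra.
have dlam : q * (lam + 1) <= d.
  have -> : d = q * (C1' * (q ^ k * l)) by rewrite /d /=; ring.
  apply: Rmult_le_compat_l; first lra.
  by rewrite /lam /C1' Rmult_assoc; nra.
have C1d : C1 * q ^ k.+1 * l <= d.
  have : 0 <= q ^ k.+1 * l by rewrite /= Rmult_assoc; nra.
  by rewrite /d /C1' !Rmult_assoc => ?; nra.
have [|||W [WA indW HW]] :=
    @indep_of_locally_sparse_log V e A d lam eirr esym lam0.
- by nra.
- move=> v vA; apply: Rle_trans C1d; apply: (IH1 t V e) => //.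
    exact: clique_nbhd cl vA.
  by move=> S SA; apply: ind; apply: subset_trans SA (subsetIr _ _).
- move=> u v vA uA; apply: (IH0 t V e) => //; rewrite -setIA.
    by apply: clique_nbhd uA => //; exact: clique_nbhd cl vA.
  move=> S SA; apply: ind; apply: subset_trans SA _.
  by rewrite setIA subsetIr.
have lD : l / 2 <= ln (d / (lam + 1)).
  (* ln q = l - ln l, and [double_le_exp] gives ln l at most l/2. *)
  have lq : l / 2 <= ln q.
    rewrite /q /Rdiv -/l ln_mult; [|lra|by apply: Rinv_0_lt_compat; lra].
    rewrite ln_Rinv -/l; last lra.
    suff : ln l <= l / 2 by lra.
    rewrite -[X in _ <= X]ln_exp; apply: ln_le; first lra.
    by rewrite {1}(_ : l = 2 * (l / 2)); [apply: double_le_exp; lra | field].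
  apply: Rle_trans lq _; apply: ln_le; first lra.
  by apply: (Rmult_le_reg_r (lam + 1)); [lra | rewrite /Rdiv Rmult_assoc Rinv_l; lra].
have Wt : INR #|W| <= INR t by apply: le_INR; apply/leP; apply: ind.
have d0 : 0 <= d by nra.
have A0 := pos_INR #|A|.
have main : l / 2 * INR #|A| <= 16 * d * INR t by nra.
apply: (Rmult_le_reg_l (l / 2)); first lra.
apply: Rle_trans main _; right; rewrite /d /=.
have -> : INR t = q * l by rewrite /q -/l; field; lra.
by field.
Qed.

(** * Part (ii): blue copies of disjoint cliques and the choice of their sizes *)

Lemma ramsey_prop_disjoint_cliques (s : nat) :
  exists C : R, 0 < C /\
    forall (t j n : nat) (V : finType) (G : rel V) (h : V -> 'I_j * 'I_t),
      (2 <= t)%N -> irreflexive G -> injective h ->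
      (forall x y, G x y -> (h x).1 = (h y).1) ->
      C * (INR t / ln (INR t)) ^ s * ln (INR t) + INR j * INR t + 1 <= INR n ->
      ramsey_prop s.+1 G n.
Proof.
have [C [C0 HC]] := clique_indep_bound s.
exists C; split=> // t j n V G h t2 Girr hinj hG nbig.
set F := C * _ ^ s * _ in nbig.
have F0 : 0 <= F.
  have [T1 T2 T3] := ln_ratio_bounds t2.
  by rewrite /F; do 2?[apply: Rmult_le_pos]; try lra; apply: pow_le; lra.
have jt0 : 0 <= INR j * INR t by apply: Rmult_le_pos; exact: pos_INR.
have n0 : (0 < n)%N by apply/ltP/INR_lt; rewrite /=; lra.
apply/forallP => Red; rewrite -implyNb; apply/implyP => noK.
pose e := red_rel Red.
have eirr := @red_rel_irr n Red; have esym := @red_rel_sym n Red.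
have HF (A : {set 'I_n}) : (n - j * t <= #|A|)%N ->
    exists S : {set 'I_n}, [/\ S \subset A, indep e S & #|S| = t].
  move=> cA.
  (* If all red-independent subsets of [A] had size at most [t], then [#|A|] would be at most [F],
     whereas the summand 1 in [nbig] forces [#|A| > F]. A larger independent set is cut down to size
     [t]. *)
  case: (boolP [exists S : {set 'I_n}, (S \subset A) && indep e S && (t < #|S|)%N]).
    case/existsP => S /andP[/andP[SA iS] tS].
    have [B BS cB] := exists_subset_card (ltnW tS).
    by exists B; split=> //; [exact: subset_trans BS SA | exact: indepS iS].
  rewrite negb_exists => /forallP noS; exfalso.
  have : INR #|A| <= F.
    apply: (HC t _ e A) => // [S SA clS | S SA iS]; first exact: card_red_clique clS.
    by have := noS S; rewrite SA iS /= -leqNgt.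
  have : INR n <= INR #|A| + INR j * INR t.
    rewrite -mult_INR -plus_INR; apply: le_INR; apply/leP.
    by rewrite plusE multE addnC -leq_subLR.
  lra.
have [|g [g1 g2]] := @disjoint_indep_sets _ e t (n - j * t) j setT HF.
  rewrite cardsT card_ord subnK //; apply/leP/INR_le; rewrite mult_INR; lra.
pose x0 := Ordinal n0.
(* Vertex number b of copy a goes to the b-th element of [g a]; the default [x0] is never reached,
   since [g a] has [t] elements. *)
pose f := [ffun x : V => nth x0 (enum (g (h x).1)) (h x).2].
have sz (a : 'I_j) : size (enum (g a)) = t by rewrite -cardE; case: (g1 a (ltn_ord a)).
have fg x : f x \in g (h x).1 by rewrite ffunE -mem_enum mem_nth // sz.
have finj : injective f.
  move=> x y fxy; apply: hinj.
  have h1 : (h x).1 = (h y).1.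
    apply/val_inj/eqP; apply: contraT => /(g2 _ _ (ltn_ord _) (ltn_ord _)).
    by move/pred0P/(_ (f x)); rewrite /= {2}fxy !fg.
  move: fxy; rewrite !ffunE h1 => /eqP; rewrite nth_uniq ?sz ?enum_uniq // => /eqP /val_inj h2.
  by move: h1 h2; case: (h x) => ? ?; case: (h y) => ? ? /= -> ->.
apply/existsP; exists f; apply/andP; split; first exact/injectiveP.
apply/forallP => x; apply/forallP => y; apply/implyP => Gxy.
have [_ /indepP ind _] := g1 _ (ltn_ord (h x).1).
have := ind (f x) (f y) (fg x); rewrite (hG _ _ Gxy) fg => /(_ isT).
rewrite /e /red_rel (inj_eq finj); case: eqP => // xy.
by rewrite xy Girr in Gxy.
Qed.

Lemma nat_ceil (x : R) : 0 <= x -> exists n : nat, x <= INR n <= x + 1.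
Proof.
move=> x0; have [up1 up2] := archimed x.
have up0 : (0 <= up x)%Z by apply: le_IZR; lra.
by exists (Z.to_nat (up x)); rewrite INR_IZR_INZ Z2Nat.id //; lra.
Qed.

Lemma INR_bin2 (t : nat) : 2 * INR 'C(t, 2) = INR t * (INR t - 1).
Proof.
have := bin_ffact t 2; rewrite ffactnSr ffactn1 => /(congr1 INR).
rewrite !mult_INR; case: t => [|t]; first by rewrite /=; lra.
by rewrite subn1 succnK (S_INR t) /=; lra.
Qed.

(** Take cliques of size about [y] = m^(1/s) (ln m)^((s-2)/s) and about 2m/y^2 of them. This [y]
    balances the two costs: their total number of vertices, of order m/y, and the
    Ajtai-Komlos-Szemeredi bound, of order y (y / ln m)^(s-2), both have the order of the target
    [B]. *)
Lemma ramsey_upper (s : nat) : (3 <= s)%N ->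
  exists C : R, 0 < C /\
     exists M : nat, forall m : nat, (M <= m)%N ->
     exists (V : finType) (G : rel V), simple_graph G /\ n_edges G = m /\
       INR (ramsey s G)
          <= C * Rpower (INR m) ((INR s - 1) / INR s)
               / Rpower (ln (INR m)) ((INR s - 2) / INR s).
Proof.
case: s => [|[|k]] // k0.
set s := k.+2.
have [C [C0 HC]] := ramsey_prop_disjoint_cliques k.+1.
have S3 : 3 <= INR s by have := le_INR 3 _ (leP k0); rewrite /=; lra.
have Sk : INR s = INR k + 2 by rewrite /s !S_INR; ring.
(* The first summand bounds [F / B], by [t <= 3 * y] and [ln t >= l / s]. The 11 is 9 for [j * t]
   plus 2 for roundings, as [B >= 1]. *)
pose C' := C * 3 * (3 * INR s) ^ k + 11.
have C'0 : 0 < C'.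
  have : 0 <= C * 3 * (3 * INR s) ^ k by apply: Rmult_le_pos; [lra | apply: pow_le; lra].
  rewrite /C'; lra.
(* From [m >= 3] follows ln m >= 1, so that ln ln m is nonnegative. *)
exists C'; split=> //; exists 3%N => m m3.
have M3 : 3 <= INR m by have := le_INR 3 _ (leP m3); rewrite /=; lra.
set l := ln (INR m).
have el : INR m = exp l by rewrite /l exp_ln //; lra.
have l1 : 1 <= l.
  rewrite -(ln_exp 1); apply: ln_le; first exact: exp_pos.
  by apply: Rle_trans exp_le_3 _.
set b := ln l.
have eb : l = exp b by rewrite /b exp_ln //; lra.
have b0 : 0 <= b by rewrite /b -ln_1; apply: ln_le; lra.
have bl : 2 * b <= l by rewrite [X in _ <= X]eb; exact: double_le_exp.
pose Y := l / INR s + INR k * b / INR s.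
have Yl : l / INR s <= Y.
  rewrite /Y; suff : 0 <= INR k * b / INR s by lra.
  apply: Rmult_le_pos; first by apply: Rmult_le_pos => //; exact: pos_INR.
  by apply: Rlt_le; apply: Rinv_0_lt_compat; lra.
have ls0 : 0 < l / INR s by apply: Rdiv_lt_0_compat; lra.
pose y := exp Y.
have y1 : 1 <= y by have := exp_ineq1_le Y; rewrite /y; lra.
pose B := exp ((INR s - 1) / INR s * l - (INR s - 2) / INR s * b).
have -> : C' * Rpower (INR m) ((INR s - 1) / INR s) / Rpower l ((INR s - 2) / INR s) = C' * B.
  rewrite /Rpower -/l -/b /B /Rminus exp_plus exp_Ropp /Rdiv; ring.
have my : INR m / y = B.
  rewrite el /y /Rdiv -exp_Ropp -exp_plus /B; congr exp.
  by rewrite /Y Sk; field; lra.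
have yB : y <= B.
  apply: exp_le; apply: Rminus_le.
  have -> : Y - ((INR s - 1) / INR s * l - (INR s - 2) / INR s * b)
          = - (INR k * (l - 2 * b) / INR s) by rewrite /Y Sk; field; lra.
  suff : 0 <= INR k * (l - 2 * b) / INR s by lra.
  apply: Rmult_le_pos; first by apply: Rmult_le_pos; [exact: pos_INR | lra].
  by apply: Rlt_le; apply: Rinv_0_lt_compat; lra.
have yyl : y * (y / l) ^ k = B.
  have -> : y / l = exp (Y - b) by rewrite /Rminus exp_plus exp_Ropp -eb.
  rewrite -Rpower_pow; last exact: exp_pos.
  rewrite /Rpower ln_exp -exp_plus /B; congr exp.
  by rewrite /Y Sk; field; lra.
(* Rounding up from [y + 1] gives t(t - 1) >= y^2, and [t <= y + 2 <= 3 * y]. *)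
have [|t [t1 t2]] := @nat_ceil (y + 1); first lra.
have t3y : INR t <= 3 * y by lra.
have t2' : (2 <= t)%N by apply/leP/INR_le; rewrite /=; lra.
have my2 : 0 <= 2 * INR m / (y * y).
  by apply: Rlt_le; apply: Rdiv_lt_0_compat; nra.
have [j [j1 j2]] := nat_ceil my2.
have mjt : (m <= j * 'C(t, 2))%N.
  apply/leP/INR_le; rewrite mult_INR.
  have c2 : y * y <= 2 * INR 'C(t, 2) by rewrite INR_bin2; nra.
  have : 2 * INR m <= INR j * (y * y).
    have -> : 2 * INR m = 2 * INR m / (y * y) * (y * y) by field; lra.
    by apply: Rmult_le_compat_r; nra.
  have := pos_INR j; nra.
have [G [sG nG hG]] := disjoint_cliques_subgraph mjt.
exists ('I_j * 'I_t)%type, G; split=> //; split=> //.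
have [T1 T2 T3] := ln_ratio_bounds t2'.
set F := C * (INR t / ln (INR t)) ^ k.+1 * ln (INR t).
have jt : INR j * INR t <= 6 * B + 3 * B.
  have : INR j * INR t <= (2 * INR m / (y * y) + 1) * (3 * y).
    by apply: Rmult_le_compat; rewrite //; exact: pos_INR.
  have -> : (2 * INR m / (y * y) + 1) * (3 * y) = 6 * (INR m / y) + 3 * y by field; lra.
  by rewrite my; lra.
have Fle : F <= C * 3 * (3 * INR s) ^ k * B.
  have tl : INR t / ln (INR t) <= 3 * INR s * (y / l).
    have lnt : l / INR s <= ln (INR t).
      apply: Rle_trans Yl _; rewrite -(ln_exp Y); apply: ln_le; first exact: exp_pos.
      by rewrite -/y; lra.
    have -> : 3 * INR s * (y / l) = 3 * y * / (l / INR s) by field; lra.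
    apply: Rmult_le_compat; [lra | | lra |].
      by apply: Rlt_le; apply: Rinv_0_lt_compat; lra.
    exact: Rinv_le_contravar.
  have -> : F = C * (INR t * (INR t / ln (INR t)) ^ k) by rewrite /F /=; field; lra.
  rewrite !Rmult_assoc; apply: Rmult_le_compat_l; first lra.
  have -> : 3 * ((3 * INR s) ^ k * B) = 3 * y * (3 * INR s * (y / l)) ^ k.
    by rewrite (Rpow_mult_distr (3 * INR s)) -yyl; ring.
  apply: Rmult_le_compat; [lra | by apply: pow_le; lra | lra |].
  by apply: pow_incr; lra.
have F0 : 0 <= F.
  by rewrite /F; do 2?[apply: Rmult_le_pos]; try lra; apply: pow_le; lra.
have jt0 : 0 <= INR j * INR t by apply: Rmult_le_pos; exact: pos_INR.
have [|n [n1 n2]] := @nat_ceil (F + INR j * INR t + 1); first lra.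
have rn : (ramsey s G <= n)%N.
  by apply: ramsey_le; apply: (HC t j n _ G id) => //; case: sG.
apply: Rle_trans (le_INR _ _ (leP rn)) _.
rewrite /C' Rmult_plus_distr_r; lra.
Qed.

(** * Part (i): existence of the Ramsey number and the choice of the weight *)

Lemma ramsey_prop_exists (s : nat) (V : finType) (G : rel V) :
  irreflexive G -> exists n, ramsey_prop s.+1 G n.
Proof.
move=> Girr; have [C [C0 HC]] := ramsey_prop_disjoint_cliques s.
(* A single clique ([j = 1]) contains [G]; the maximum with 2 meets the requirement [2 <= t]. *)
pose t := maxn 2 #|V|.
have Vt : (#|V| <= t)%N by rewrite leq_maxr.
pose h (x : V) : 'I_1 * 'I_t := (ord0, widen_ord Vt (enum_rank x)).
pose b := C * (INR t / ln (INR t)) ^ s * ln (INR t) + INR 1 * INR t + 1.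
have [n [bn _]] := nat_ceil (Rmax_r b 0).
exists n; apply: (HC t 1%N n V G h) => //.
- by rewrite leq_maxl.
- by move=> x y [] /val_inj/enum_rank_inj.
- by apply: Rle_trans bn; exact: Rmax_l.
Qed.

(** exp(-x/2) >= 1 - x/2, and (1 + x)(1 - x/2) >= 1 on [0, 1]. *)
Lemma exp_half_le (x : R) : 0 <= x <= 1 -> exp (x / 2) <= 1 + x.
Proof.
move=> [x0 x1]; have e0 := exp_pos (x / 2).
have := exp_ineq1_le (- (x / 2)); rewrite exp_Ropp => H.
have : (1 - x / 2) * exp (x / 2) <= 1.
  rewrite -[X in _ <= X](Rinv_l (exp (x / 2))); last lra.
  by apply: Rmult_le_compat_r; lra.
nra.
Qed.

Lemma exp_pow (x : R) (n : nat) : exp x ^ n = exp (INR n * x).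
Proof.
by rewrite -Rpower_pow; [rewrite /Rpower ln_exp | exact: exp_pos].
Qed.

(** Take x = n^(-2/(a+1)) / 4 with a = s + 2. Then (1 + x)^m is at least exp(mx/2), and each of the
    two factors on the left takes at most half of this exponent: n ln n < mx/4 by the bound on n,
    and the clique factor is at most exp(mx/4). *)
Lemma union_bound_small (s n m : nat) :
  (1 <= s)%N -> (1 <= n)%N -> (2 <= m)%N ->
  INR n < / 64 * Rpower (INR m / ln (INR m)) ((INR s.+2 + 1) / (INR s.+2 + 3)) ->
  exists x : R, 0 < x /\
    INR n ^ n * (1 + x ^ 'C(s.+2, 2)) ^ (m * n ^ s) < (1 + x) ^ m.
Proof.
move=> s1 n1 m2; set a := INR s.+2; set p := (a + 1) / (a + 3); set l := ln (INR m).
have N1 : 1 <= INR n by apply: (le_INR 1); apply/leP.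
have [M2 l2 _] := ln_ratio_bounds m2; rewrite -/l in l2.
have S1 : 1 <= INR s by apply: (le_INR 1); apply/leP.
have aE : a = INR s + 2 by rewrite /a !S_INR; ring.
set u := ln (INR n).
have eu : INR n = exp u by rewrite /u exp_ln //; lra.
have u0 : 0 <= u by rewrite /u -ln_1; apply: ln_le; lra.
move=> nlt.
have p0 : 0 < p by apply: Rdiv_lt_0_compat; lra.
have up : u / p = u + 2 * u / (a + 1) by rewrite /p; field; lra.
have uup : u <= u / p.
  by rewrite up; suff : 0 <= 2 * u / (a + 1) by [lra]; apply: Rle_mult_inv_pos; lra.
have X0 : 0 < INR m / l by apply: Rdiv_lt_0_compat; lra.
(* u < p ln X - ln 64 with p <= 1, hence exp (u / p) < X / 64. *)
have eup : exp (u / p) < / 64 * (INR m / l).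
  have : u < ln (/ 64) + p * ln (INR m / l).
    have r0 : 0 < Rpower (INR m / l) p by exact: exp_pos.
    have := ln_increasing (INR n) _ _ nlt.
    by rewrite ln_mult //; [rewrite ln_exp; apply; lra | lra].
  have c0 : ln (/ 64) < 0 by rewrite -ln_1; apply: ln_increasing; lra.
  have p1 : p <= 1.
    by apply: (Rmult_le_reg_r (a + 3)); [lra | rewrite /p /Rdiv Rmult_assoc Rinv_l; lra].
  have pp : p * (u / p) = u by field; lra.
  move=> ult; rewrite -(exp_ln (/ 64 * (INR m / l))); last by apply: Rmult_lt_0_compat; lra.
  rewrite ln_mult; [|lra|lra]; apply: exp_increasing.
  by apply: (Rmult_lt_reg_l p) => //; rewrite pp; nra.
have ul : u <= l.
  apply: Rle_trans uup _; rewrite -(ln_exp (u / p)); apply: ln_le; first exact: exp_pos.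
  apply: Rle_trans (Rlt_le _ _ eup) _.
  have -> : / 64 * (INR m / l) = INR m * (/ (64 * l)) by field; lra.
  rewrite -[X in _ <= X]Rmult_1_r; apply: Rmult_le_compat_l; first lra.
  by rewrite -Rinv_1; apply: Rinv_le_contravar; lra.
set w := exp (- (2 * u / (a + 1))).
have w0 : 0 < w by exact: exp_pos.
have w1 : w <= 1.
  rewrite -exp_0; apply: exp_le.
  by suff : 0 <= 2 * u / (a + 1) by [lra]; apply: Rle_mult_inv_pos; lra.
exists (/ 4 * w); set x := / 4 * w; split; first by rewrite /x; lra.
have x0 : 0 < x by rewrite /x; lra.
have Mx : 0 < INR m * x by apply: Rmult_lt_0_compat; lra.
have H1 : INR n ^ n <= exp (INR n * u) by rewrite -exp_pow -eu; right.
have H2 : (1 + x ^ 'C(s.+2, 2)) ^ (m * n ^ s) <= exp (INR m * x / 4).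
  apply: Rle_trans (pow_1_plus_le_exp _ _) _; first by apply: pow_le; lra.
  apply: exp_le; rewrite mult_INR.
  have -> : INR (n ^ s) = INR n ^ s.
    by elim: (s) => //= k IH; rewrite expnS mult_INR IH.
  have b1 : (1 < 'C(s.+2, 2))%N.
    by rewrite binS bin1 (leq_trans _ (leq_addl _ _)).
  have := INR_bin2 s.+2; case: 'C(s.+2, 2) b1 => // b b1; rewrite -/a S_INR aE => bE.
  (* Here [b] is C(a,2) - 1 = (a + 1)(a - 2)/2, so the powers of [n] cancel exactly and (1/4)^b
     remains. *)
  have xb : x ^ b * INR n ^ s <= / 4.
    rewrite /x Rpow_mult_distr Rmult_assoc /w eu !exp_pow -exp_plus.
    have -> : INR b * - (2 * u / (a + 1)) + INR s * u = 0.
      rewrite (_ : INR b = (INR s + 3) * INR s / 2); last by lra.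
      by rewrite aE; field; lra.
    rewrite exp_0 Rmult_1_r; case: (b) b1 => // b' _ /=.
    rewrite -[X in _ <= X]Rmult_1_r; apply: Rmult_le_compat_l; first lra.
    by rewrite -(pow1 b'); apply: pow_incr; lra.
  rewrite (_ : _ * _ = INR m * x * (x ^ b * INR n ^ s)); last by rewrite /=; ring.
  by nra.
have H3 : exp (INR m * x / 2) <= (1 + x) ^ m.
  rewrite (_ : INR m * x / 2 = INR m * (x / 2)); last by field.
  rewrite -exp_pow; apply: pow_incr; split; first exact: Rlt_le (exp_pos _).
  by apply: exp_half_le; rewrite /x; lra.
have H4 : INR n * u < INR m * x / 4.
  (* n = n^(1/p) n^(-2/(a+1)), and n^(1/p) ln n <= m/64 because ln n <= ln m; this gives n ln n <=
     mw/64, against mx/4 = mw/16. *)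
  have -> : INR n = exp (u / p) * w.
    by rewrite eu /w -exp_plus up; congr exp; ring.
  have : exp (u / p) * u <= INR m / 64.
    have -> : INR m / 64 = / 64 * (INR m / l) * l by field; lra.
    by apply: Rmult_le_compat; [exact: Rlt_le (exp_pos _) | lra | lra | lra].
  have : 0 < INR m * w by apply: Rmult_lt_0_compat; lra.
  rewrite /x; nra.
apply: Rlt_le_trans H3.
apply: (Rle_lt_trans _ (exp (INR n * u) * exp (INR m * x / 4))).
  apply: Rmult_le_compat => //; apply: pow_le; first lra.
  by suff : 0 <= x ^ 'C(s.+2, 2) by [lra]; apply: pow_le; lra.
by rewrite -exp_plus; apply: exp_increasing; lra.
Qed.

(** The union bound is applied at n = r(K_s, G) itself. The Ramsey property holds there, which
    yields [#|V| <= n] and contradicts [not_ramsey_prop_INR]. *)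
Lemma ramsey_lower (s m : nat) (V : finType) (G : rel V) :
  (3 <= s)%N -> (2 <= m)%N -> simple_graph G -> n_edges G = m ->
  / 64 * Rpower (INR m / ln (INR m)) ((INR s + 1) / (INR s + 3)) <= INR (ramsey s G).
Proof.
case: s => [|[|s]] // s3 m2 [Girr _] nG; apply: Rnot_lt_le => small.
have rG := ramsey_propP (ramsey_prop_exists s.+1 Girr).
have Vn := ramsey_prop_card rG.
have n1 : (1 <= ramsey s.+2 G)%N.
  by apply: leq_trans Vn; apply: (@n_edges_card V G); rewrite nG ltnW.
have [x [x0 Hx]] := union_bound_small s3 n1 m2 small.
by rewrite -nG in Hx; move/negP: (not_ramsey_prop_INR x0 Vn Hx).
Qed.

Theorem theorem1 (s : nat) (hs : (3 <= s)%N) :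
  (exists c : R, 0 < c /\
     forall m : nat, (2 <= m)%N ->
     forall (V : finType) (G : rel V), simple_graph G -> n_edges G = m ->
       (c * Rpower (INR m / ln (INR m)) ((INR s + 1) / (INR s + 3))
          <= INR (ramsey s G)))
  /\
  (exists C : R, 0 < C /\
     exists M : nat, forall m : nat, (M <= m)%N ->
     exists (V : finType) (G : rel V), simple_graph G /\ n_edges G = m /\
       INR (ramsey s G)
          <= C * Rpower (INR m) ((INR s - 1) / INR s)
               / Rpower (ln (INR m)) ((INR s - 2) / INR s)).
Proof.
split; last exact: ramsey_upper.
exists (/ 64); split; first lra.
by move=> m m2 V G; exact: ramsey_lower.
Qed.
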